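(* The algebra $\mathbf{S}(\pi)$ is a homomorphic image of $\mathbf{U}$: there is a surjective homomorphism of $\mathbb{Q}(v)$-algebras $\mathbf{U}\to\mathbf{S}(\pi)$ sending the generators $E_i,F_i,K_i,K_i^{-1}$ of $\mathbf{U}$ to the elements of $\mathbf{S}(\pi)$ denoted by the same symbols ($1\le i\le n$).
   Context: Root data. Let $(a_{ij})_{1\le i,j\le n}$ be a Cartan matrix of finite type (not assumed indecomposable): integers with $a_{ii}=2$, $a_{ij}\le 0$ for $i\ne j$, and there are $d_i\in\{1,2,3\}$ with $(d_ia_{ij})$ symmetric and positive definite. Let $\mathfrak{g}$ be the corresponding semisimple Lie algebra over $\mathbb{Q}$, $\mathfrak{h}$ its Cartan subalgebra, $\alpha_i\in\mathfrak{h}^*$ the simple roots, $\alpha_i^\vee\in\mathfrak{h}$ the simple coroots, $\langle\alpha_i^\vee,\alpha_j\rangle=a_{ij}$, $W$ the Weyl group. Let $X=\{\lambda\in\mathfrak{h}^*\mid\langle\alpha_i^\vee,\lambda\rangle\in\mathbb{Z}\ \forall i\}$, $X^+=\{\lambda\in X\mid\langle\alpha_i^\vee,\lambda\rangle\ge0\ \forall i\}$, and write $\lambda\le\mu$ if $\mu-\lambda\in\sum_i\mathbb{N}\alpha_i$. Let $\pi\subset X^+$ be a finite saturated set, i.e. $\mu\in\pi$, $\lambda\in X^+$, $\lambda\le\mu$ imply $\lambda\in\pi$. Let $W\pi=\{w\mu\mid w\in W,\mu\in\pi\}$. Quantum notation. $v$ is an indeterminate, $v_i=v^{d_i}$, $[a]_i=(v_i^a-v_i^{-a})/(v_i-v_i^{-1})$,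 $\begin{bmatrix}a\\t\end{bmatrix}_i=\prod_{s=0}^{t-1}(v_i^{a-s}-v_i^{-a+s})/\prod_{s=1}^t(v_i^s-v_i^{-s})$ for $a\in\mathbb{Z}$, $t\in\mathbb{N}$. The algebra $\mathbf{S}(\pi)$. It is the associative unital $\mathbb{Q}(v)$-algebra with generators $E_i,F_i$ ($1\le i\le n$), $1_\lambda$ ($\lambda\in W\pi$) and relations: $1_\lambda1_\mu=\delta_{\lambda\mu}1_\lambda$, $\sum_{\lambda\in W\pi}1_\lambda=1$; $E_iF_j-F_jE_i=\delta_{ij}\sum_{\lambda\in W\pi}[\langle\alpha_i^\vee,\lambda\rangle]_i1_\lambda$; $E_i1_\lambda=1_{\lambda+\alpha_i}E_i$ if $\lambda+\alpha_i\in W\pi$ and $E_i1_\lambda=0$ otherwise; $F_i1_\lambda=1_{\lambda-\alpha_i}F_i$ if $\lambda-\alpha_i\in W\pi$ and $F_i1_\lambda=0$ otherwise; $1_\lambda E_i=E_i1_{\lambda-\alpha_i}$ if $\lambda-\alpha_i\in W\pi$ and $1_\lambda E_i=0$ otherwise; $1_\lambda F_i=F_i1_{\lambda+\alpha_i}$ if $\lambda+\alpha_i\in W\pi$ and $1_\lambda F_i=0$ otherwise; and for $i\ne j$ the quantum Serre relations $\sum_{s=0}^{1-a_{ij}}(-1)^s\begin{bmatrix}1-a_{ij}\\ s\end{bmatrix}_iE_i^{1-a_{ij}-s}E_jE_i^s=0$ and the same with $F$ in place of $E$. In $\mathbf{S}(\pi)$ put $K_i=\sum_{\lambda\in W\pi}v_i^{\langle\alpha_i^\vee,\lambda\rangle}1_\lambda$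 and $K_i^{-1}=\sum_{\lambda\in W\pi}v_i^{-\langle\alpha_i^\vee,\lambda\rangle}1_\lambda$. The algebra $\mathbf{U}$. It is the associative unital $\mathbb{Q}(v)$-algebra with generators $E_i,F_i,K_i,K_i^{-1}$ ($1\le i\le n$) and relations $K_iK_j=K_jK_i$, $K_iK_i^{-1}=1=K_i^{-1}K_i$; $E_iF_j-F_jE_i=\delta_{ij}(K_i-K_i^{-1})/(v_i-v_i^{-1})$; $K_iE_j=v_i^{a_{ij}}E_jK_i$, $K_iF_j=v_i^{-a_{ij}}F_jK_i$; and the same quantum Serre relations in the $E$'s and in the $F$'s for $i\neq j$. *)

(* Defs.v *)
From HB Require Import structures.
From mathcomp Require Import all_boot all_order all_algebra ring lra zify.
From mathcomp Require Import boolp classical_sets functions cardinality fsbigop.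
From mathcomp Require Import finmap monalg.

Set Implicit Arguments.
Unset Strict Implicit.
Unset Printing Implicit Defensive.

Import Order.TTheory GRing.Theory Num.Theory.
Local Open Scope classical_set_scope.
Local Open Scope ring_scope.
Local Open Scope quotient_scope.


Section PresentedAlgebra.
Variables (K : comNzRingType) (I : choiceType).

Definition free_algebra : Type := {malg K[{fmonom I}]}.
HB.instance Definition _ := GRing.Lalgebra.on free_algebra.

Definition free_gen (i : I) : free_algebra := << fmu i >>.

Fact free_scalerAr (c : K) (x y : free_algebra) :
  c *: (x * y) = x * (c *: y).
Proof.
apply/malgP => m; rewrite mcoeffZ.
rewrite (mcoeffMlw _ (fsubset_refl _) (fsubset_refl _)).
rewrite (mcoeffMlw _ (fsubset_refl _) (msuppZ_le c y)).
rewrite mulr_sumr; apply: eq_bigr => k1 _.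
rewrite mulr_sumr; apply: eq_bigr => k2 _.
by rewrite mcoeffZ mulrnAr mulrCA.
Qed.
HB.instance Definition _ := GRing.Lalgebra_isAlgebra.Build K free_algebra
  free_scalerAr.

Definition two_sided_ideal (J : set free_algebra) : Prop :=
  [/\ J 0, forall x y, J x -> J y -> J (x - y)
    & forall x l r, J x -> J (l * x * r)].

(* rel x y stands for the defining relation x = y *)
Variable rel : free_algebra -> free_algebra -> Prop.

Definition rel_ideal : set free_algebra :=
  smallest two_sided_ideal [set z | exists x y, rel x y /\ z = x - y].

Lemma rel_ideal_two_sided : two_sided_ideal rel_ideal.
Proof.
split=> [J [[]]//|x y Jx Jy J HJ|x l r Jx J HJ].
  by have [[_ JB _] _] := HJ; apply: JB; [exact: Jx|exact: Jy].
by have [[_ _ JM] _] := HJ; apply: JM; exact: Jx.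
Qed.

Definition rel_pred : {pred free_algebra} := [pred x | `[< rel_ideal x >]].

Fact rel_pred_zmod : zmod_closed rel_pred.
Proof.
have [J0 JB _] := rel_ideal_two_sided.
split=> [|x y]; first exact/asboolP.
by move=> /asboolP Jx /asboolP Jy; apply/asboolP; exact: JB.
Qed.
HB.instance Definition _ := GRing.isZmodClosed.Build free_algebra rel_pred
  rel_pred_zmod.

(* The free algebra modulo rel_ideal.  It may be the zero algebra (for instance
   S_algebra below when P is empty), so it only gets pzRingType and lmodType
   structures, not algType, which forces 1 != 0; the compatibility axioms of an
   algebra are pres_scalerAl and pres_scalerAr. *)
Definition presented : Type := {ideal_quot rel_pred}.
HB.instance Definition _ := GRing.Zmodule.on presented.

Local Notation piQ := (\pi_({ideal_quot rel_pred})).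

Definition pres_one : presented := piQ 1.
Definition pres_mul (x y : presented) : presented :=
  piQ ((repr x : free_algebra) * (repr y : free_algebra)).
Definition pres_scale (c : K) (x : presented) : presented :=
  piQ (c *: (repr x : free_algebra)).

Definition pres_of (x : free_algebra) : presented := piQ x.

Lemma pres_ofP x y : reflect (rel_ideal (x - y)) (pres_of x == pres_of y).
Proof.
have -> : (pres_of x == pres_of y) = (x - y \in rel_pred).
  by rewrite Quotient.idealrBE.
exact: asboolP.
Qed.

Lemma pres_ofB : {morph pres_of : x y / x - y}.
Proof. by move=> x y; rewrite /pres_of !piE. Qed.

Lemma pres_of_repr (x : presented) : pres_of (repr x) = x.
Proof. exact: reprK. Qed.

Lemma rel_idealMl l x : rel_ideal x -> rel_ideal (l * x).
Proof.
by have [_ _ JM] := rel_ideal_two_sided; move/(JM _ l 1); rewrite mulr1.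
Qed.

Lemma rel_idealMr x r : rel_ideal x -> rel_ideal (x * r).
Proof.
by have [_ _ JM] := rel_ideal_two_sided; move/(JM _ 1 r); rewrite mul1r.
Qed.

Lemma rel_idealD x y : rel_ideal x -> rel_ideal y -> rel_ideal (x + y).
Proof.
have [J0 JB _] := rel_ideal_two_sided; move=> Jx Jy.
by rewrite -[y]opprK; apply: (JB) => //; rewrite -sub0r; apply: (JB).
Qed.

Lemma pres_ofM x y : pres_of (x * y) = pres_mul (pres_of x) (pres_of y).
Proof.
rewrite /pres_mul; set x' := repr _; set y' := repr _.
have /eqP/pres_ofP Jx : pres_of x = pres_of x' by rewrite pres_of_repr.
have /eqP/pres_ofP Jy : pres_of y = pres_of y' by rewrite pres_of_repr.
apply/eqP/pres_ofP.
have -> : x * y - x' * y' = (x - x') * y + x' * (y - y').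
  by rewrite mulrBl mulrBr addrA subrK.
by apply: rel_idealD; [exact: rel_idealMr|exact: rel_idealMl].
Qed.

Lemma pres_ofZ c x : pres_of (c *: x) = pres_scale c (pres_of x).
Proof.
rewrite /pres_scale; set x' := repr _.
have /eqP/pres_ofP Jx : pres_of x = pres_of x' by rewrite pres_of_repr.
apply/eqP/pres_ofP; rewrite -scalerBr -[x - x']mul1r scalerAl.
exact: rel_idealMl.
Qed.

Lemma pres_ofD : {morph pres_of : x y / x + y}.
Proof. by move=> x y; rewrite /pres_of !piE. Qed.

Fact pres_mulA : associative pres_mul.
Proof.
move=> x y z; rewrite -[x]pres_of_repr -[y]pres_of_repr -[z]pres_of_repr.
by rewrite -!pres_ofM mulrA.
Qed.
Fact pres_mul1 : left_id pres_one pres_mul.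
Proof. by move=> x; rewrite -[x]pres_of_repr -pres_ofM mul1r. Qed.
Fact pres_mulr1 : right_id pres_one pres_mul.
Proof. by move=> x; rewrite -[x]pres_of_repr -pres_ofM mulr1. Qed.
Fact pres_mulDl : left_distributive pres_mul +%R.
Proof.
move=> x y z; rewrite -[x]pres_of_repr -[y]pres_of_repr -[z]pres_of_repr.
by rewrite -pres_ofD -!pres_ofM mulrDl pres_ofD.
Qed.
Fact pres_mulDr : right_distributive pres_mul +%R.
Proof.
move=> x y z; rewrite -[x]pres_of_repr -[y]pres_of_repr -[z]pres_of_repr.
by rewrite -pres_ofD -!pres_ofM mulrDr pres_ofD.
Qed.
HB.instance Definition _ := GRing.Zmodule_isPzRing.Build presented
  pres_mulA pres_mul1 pres_mulr1 pres_mulDl pres_mulDr.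

Fact pres_scaleA a b x : pres_scale a (pres_scale b x) = pres_scale (a * b) x.
Proof. by rewrite -[x]pres_of_repr -!pres_ofZ scalerA. Qed.
Fact pres_scale1 : left_id 1 pres_scale.
Proof. by move=> x; rewrite -[x]pres_of_repr -pres_ofZ scale1r. Qed.
Fact pres_scaleDr : right_distributive pres_scale +%R.
Proof.
move=> a x y; rewrite -[x]pres_of_repr -[y]pres_of_repr.
by rewrite -pres_ofD -!pres_ofZ scalerDr pres_ofD.
Qed.
Fact pres_scaleDl x : {morph pres_scale^~ x : a b / a + b}.
Proof.
by move=> a b; rewrite -[x]pres_of_repr -!pres_ofZ scalerDl pres_ofD.
Qed.
HB.instance Definition _ := GRing.Zmodule_isLmodule.Build K presented
  pres_scaleA pres_scale1 pres_scaleDr pres_scaleDl.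

Lemma pres_scalerAl (c : K) (x y : presented) : c *: (x * y) = (c *: x) * y.
Proof.
rewrite -[x]pres_of_repr -[y]pres_of_repr.
by rewrite -[LHS]/(pres_scale c (pres_mul _ _)) -pres_ofM -pres_ofZ scalerAl
  pres_ofM pres_ofZ.
Qed.
Lemma pres_scalerAr (c : K) (x y : presented) : c *: (x * y) = x * (c *: y).
Proof.
rewrite -[x]pres_of_repr -[y]pres_of_repr.
by rewrite -[LHS]/(pres_scale c (pres_mul _ _)) -pres_ofM -pres_ofZ scalerAr
  pres_ofM pres_ofZ.
Qed.

Definition pres_gen (i : I) : presented := pres_of (free_gen i).
End PresentedAlgebra.

(* Q(v) *)
Notation Qv := {fraction {poly rat}}.
Definition qv : Qv := tofrac 'X.

Section QuantumIntegers.
Variables (n : nat) (d : 'I_n -> nat).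

Definition vi (i : 'I_n) : Qv := qv ^+ d i.

Definition qint (i : 'I_n) (x : int) : Qv :=
  (vi i ^ x - vi i ^ (- x)) / (vi i - (vi i)^-1).

Definition qbin (i : 'I_n) (x : int) (t : nat) : Qv :=
  (\prod_(0 <= s < t) (vi i ^ (x - s%:Z) - vi i ^ (- x + s%:Z))) /
  (\prod_(1 <= s < t.+1) (vi i ^+ s - vi i ^- s)).

(* Only used for i != j, where 1 - a i j is positive and absz is harmless. *)
Definition qserre (a : 'M[int]_n) (A : algType Qv) (x : 'I_n -> A)
    (i j : 'I_n) : A :=
  let m := absz (1 - a i j) in
  \sum_(0 <= s < m.+1)
    ((-1) ^+ s * qbin i (1 - a i j) s) *: (x i ^+ (m - s) * x j * x i ^+ s).

End QuantumIntegers.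

Definition symmetrized n (a : 'M[int]_n) (d : 'I_n -> nat) : 'M[int]_n :=
  \matrix_(i, j) ((d i)%:Z * a i j).

Definition posdef n (B : 'M[int]_n) : Prop :=
  forall x : 'cV[rat]_n, x != 0 -> 0 < (x^T *m map_mx intr B *m x) 0 0.

Definition finite_type_cartan n (a : 'M[int]_n) (d : 'I_n -> nat) : Prop :=
  [/\ forall i, a i i = 2,
      forall i j, i != j -> a i j <= 0,
      forall i, (1 <= d i <= 3)%N,
      (symmetrized a d)^T = symmetrized a d
    & posdef (symmetrized a d)].

Section Weights.
Variables (n : nat) (h : vectType rat).

Local Notation hdual := 'Hom(h, rat^o).

(* h is the Cartan subalgebra: since g is semisimple, the simple coroots form a
   basis of h, and the simple roots are determined by the Cartan matrix. *)
Definition realization (a : 'M[int]_n) (coroot : n.-tuple h)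
    (root : n.-tuple hdual) : Prop :=
  basis_of fullv coroot /\ forall i j : 'I_n, root`_j coroot`_i = (a i j)%:~R.

Variables (coroot : n.-tuple h) (root : n.-tuple hdual).

Definition integral_weight : set hdual :=
  [set l | forall i : 'I_n, l coroot`_i \is a Num.int].

Definition dominant_weight : set hdual :=
  [set l | integral_weight l /\ forall i : 'I_n, 0 <= l coroot`_i].

Definition weight_le (l m : hdual) : Prop :=
  exists c : 'I_n -> nat, m - l = \sum_(i < n) root`_i *+ c i.

Definition saturated (P : set hdual) : Prop :=
  forall m l, P m -> dominant_weight l -> weight_le l m -> P l.

Definition simple_refl (i : 'I_n) (l : hdual) : hdual := l - l coroot`_i *: root`_i.

(* The simple reflections are involutions, so the monoid they generate is a
   group. *)
Inductive weyl : (hdual -> hdual ) -> Prop :=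
| weyl_id : weyl id
| weyl_refl i : weyl (simple_refl i)
| weyl_comp w1 w2 : weyl w1 -> weyl w2 -> weyl (w1 \o w2).

Definition weyl_orbits (P : set hdual ) : set hdual :=
  [set l | exists w m, [/\ weyl w, P m & l = w m]].

(* <alpha_i^vee, l> as an int; the value is exact on W P, see wtE. *)
Definition wt (i : 'I_n) (l : hdual ) : int := Num.floor (l coroot`_i : rat).

End Weights.

Section WeylOrbitsFinite.
Variables (n : nat) (a : 'M[int]_n) (d : 'I_n -> nat) (h : vectType rat).
Variables (coroot : n.-tuple h) (root : n.-tuple 'Hom(h, rat^o)).
Hypothesis cartan_a : finite_type_cartan a d.
Hypothesis real_a : realization a coroot root.

Lemma weyl_integral w l : weyl coroot root w ->
  integral_weight coroot l -> integral_weight coroot (w l).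
Proof.
move=> Ww; elim: Ww l => {w}[|i|w1 w2 _ IH1 _ IH2] l Xl //; last first.
  by apply: IH1; apply: IH2.
have [_ rootE] := real_a => j.
rewrite /simple_refl !lfun_simp /= rootE.
by rewrite rpredB ?rpredM ?rpred_int //; exact: Xl.
Qed.

Lemma wtE P i l : P `<=` dominant_weight coroot ->
  weyl_orbits coroot root P l -> (wt coroot i l)%:~R = l coroot`_i :> rat.
Proof.
move=> PX [w [m [Ww Pm ->]]]; apply: floorK.
by apply: (weyl_integral Ww); have [] := PX _ Pm.
Qed.

Let A : 'M[rat]_n := map_mx intr a.
Let D : 'M[rat]_n := diag_mx (\row_i (d i)%:R).
Let B : 'M[rat]_n := map_mx intr (symmetrized a d).

Let BE : B = D *m A.
Proof.
apply/matrixP => i j; rewrite mul_diag_mx !mxE rmorphM /=.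
by [].
Qed.

Let Bsym : B^T = B.
Proof. by have [_ _ _ + _] := cartan_a; rewrite /B map_trmx => ->. Qed.

Let Aunit : A \in unitmx.
Proof.
have [_ _ _ _ Bpos] := cartan_a.
rewrite -unitmx_tr -row_free_unit -kermx_eq0; apply/rowV0P => u.
move=> /sub_kermxP uA; apply/eqP; apply: contraT => u0.
have uT0 : u^T != 0 by rewrite -trmx0 (inj_eq trmx_inj).
have := Bpos _ uT0.
rewrite -mulmxA.
have -> : map_mx intr (symmetrized a d) *m u^T = 0.
  by rewrite -/B BE -mulmxA -[A *m _]trmxK trmx_mul trmxK uA trmx0 mulmx0.
by rewrite mulmx0 mxE ltxx.
Qed.

Let Q (c : 'cV[rat]_n) : rat := (c^T *m B *m c) 0 0.

Let p (l : 'Hom(h, rat^o)) : 'cV[rat]_n := \col_i (l coroot`_i : rat).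
Let N l := Q (invmx A *m p l).

Let Qshift c i t :
  Q (c - t *: delta_mx i 0) =
  Q c - 2 * t * (d i)%:R * (A *m c) i 0 + 2 * t ^+ 2 * (d i)%:R.
Proof.
have [a2 _ _ _ _] := cartan_a.
pose e : 'cV[rat]_n := delta_mx i 0.
have ec : (e^T *m B *m c) 0 0 = (d i)%:R * (A *m c) i 0.
  by rewrite /e trmx_delta -mulmxA -rowE BE -mulmxA mul_diag_mx !mxE.
have ce : (c^T *m B *m e) 0 0 = (d i)%:R * (A *m c) i 0.
  have -> : (c^T *m B *m e) 0 0 = (c^T *m B *m e)^T 0 0 by rewrite [RHS]mxE.
  by rewrite !trmx_mul trmxK Bsym mulmxA.
have ee : (e^T *m B *m e) 0 0 = 2 * (d i)%:R.
  by rewrite /e trmx_delta -rowE -colE !mxE a2 mulrC rmorphM.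
rewrite /Q -/e.
have -> : (c - t *: e)^T = c^T - t *: e^T by apply/rowP => j; rewrite !mxE.
rewrite !mulmxBl !mulmxBr.
rewrite -!scalemxAl -!scalemxAr; move: ec ce ee.
move: (c^T *m B *m c) (e^T *m B *m c) (c^T *m B *m e) (e^T *m B *m e).
move: ((A *m c) i 0) => Aci.
move=> cBc eBc cBe eBe ec ce ee; rewrite !mxE ec ce ee.
by ring.
Qed.

Let Q_ge0 c : 0 <= Q c.
Proof.
have [_ _ _ _ Bpos] := cartan_a.
have [->|/Bpos/ltW//] := eqVneq c 0.
by rewrite /Q mulmx0 mxE.
Qed.

Let p_refl i l :
  invmx A *m p (simple_refl coroot root i l) =
  invmx A *m p l - (l coroot`_i : rat) *: delta_mx i 0.
Proof.
have [_ rootE] := real_a.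
have -> : p (simple_refl coroot root i l) =
          p l - (l coroot`_i : rat) *: (A *m delta_mx i 0).
  apply/colP => j; rewrite -colE !mxE /simple_refl !lfun_simp /= rootE.
  by [].
by rewrite mulmxBr -scalemxAr mulKmx.
Qed.

Let N_weyl w l : weyl coroot root w -> N (w l) = N l.
Proof.
move=> Ww; elim: Ww l => {w}[|i|w1 w2 _ IH1 _ IH2] l //=; last first.
  by rewrite IH1 IH2.
rewrite /N p_refl Qshift mulKVmx // mxE.
by ring.
Qed.

Let N_bound (l : 'Hom(h, rat^o)) (i : 'I_n) : (l coroot`_i : rat) ^+ 2 <= 2 * N l.
Proof.
have [_ _ d13 _ _] := cartan_a.
set t : rat := l coroot`_i.
have := Q_ge0 (invmx A *m p l - (t / 2) *: delta_mx i 0).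
rewrite Qshift mulKVmx // mxE -/t -/(N l).
have d1 : 1 <= (d i)%:R :> rat by rewrite ler1n; case/andP: (d13 i).
have t2 := sqr_ge0 t.
nra.
Qed.

Lemma weyl_orbits_finite P : P `<=` dominant_weight coroot ->
  finite_set P -> finite_set (weyl_orbits coroot root P).
Proof.
move=> PX finP.
have -> : weyl_orbits coroot root P = \bigcup_(m in P)
    [set l | exists2 w, weyl coroot root w & l = w m].
  apply/seteqP; split=> l.
    by move=> [w [m [Ww Pm ->]]]; exists m => //; exists w.
  by move=> [m Pm [w Ww ->]]; exists w, m.
apply: bigcup_finite => // m Pm.
pose M := `|Num.floor (2 * N m)|%N.
pose g (v : 'I_n -> 'I_(M.*2.+1)) : 'Hom(h, rat^o) :=
  xget 0 [set l : 'Hom(h, rat^o) |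
    forall i : 'I_n, l coroot`_i = (v i)%:R - M%:R :> rat].
apply: (@sub_finite_set _ _
  ((fun v : {ffun 'I_n -> 'I_(M.*2.+1)} => g v) @` [set: _])); last first.
  by apply: finite_image; exact: finite_finset.
move=> _ [w Ww ->] /=.
have zE (i : 'I_n) : (wt coroot i (w m))%:~R = w m coroot`_i :> rat.
  by apply: (wtE _ PX); exists w, m.
have zM (i : 'I_n) : - M%:Z <= wt coroot i (w m) <= M%:Z.
  have := N_bound (w m) i; rewrite N_weyl // -zE -rmorphXn /= -floor_ge_int.
  move: (wt _ _ _) => z zf; have zM : z * z <= M%:Z.
    by rewrite -expr2; apply: le_trans zf (lez_abs _).
  have M0 : 0 <= M%:Z by [].
  by clearbody M; apply/andP; split; nia.
exists [ffun i => inord (absz (wt coroot i (w m) + M%:Z))] => //.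
set v := [ffun i => _].
have vE (i : 'I_n) : w m coroot`_i = (v i)%:R - M%:R :> rat.
  have /andP[z1 z2] := zM i.
  rewrite /v ffunE inordK; last by lia.
  rewrite -zE -[_%:R]/((_ : nat)%:~R) gez0_abs ?rmorphD /=; last by lia.
  by rewrite addrK.
have gE (i : 'I_n) : g v coroot`_i = (v i)%:R - M%:R :> rat.
  move: i.
  by apply: (@xgetPex _ 0 [set l : 'Hom(h, rat^o) |
    forall i : 'I_n, l coroot`_i = (v i)%:R - M%:R :> rat]); exists (w m).
have [cb _] := real_a.
apply/lfunP => x; rewrite (coord_basis cb (memvf x)) !linear_sum.
by apply: eq_bigr => i _; rewrite !linearZ /=; congr (_ *: _); rewrite vE gE.
Qed.

End WeylOrbitsFinite.

Inductive U_generator (n : nat) : Type :=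
  UE of 'I_n | UF of 'I_n | UK of 'I_n | UKinv of 'I_n.
HB.instance Definition _ n := gen_eqMixin (U_generator n).
HB.instance Definition _ n := gen_choiceMixin (U_generator n).

Section QuantumGroup.
Variables (n : nat) (a : 'M[int]_n) (d : 'I_n -> nat).

Local Notation FU := (free_algebra Qv (U_generator n)).
Local Notation E i := (free_gen Qv (UE i) : FU).
Local Notation F i := (free_gen Qv (UF i) : FU).
Local Notation K i := (free_gen Qv (UK i) : FU).
Local Notation Kinv i := (free_gen Qv (UKinv i) : FU).

Inductive U_rel : FU -> FU -> Prop :=
| U_KK (i j : 'I_n) : U_rel (K i * K j) (K j * K i)
| U_KKinv (i : 'I_n) : U_rel (K i * Kinv i) 1
| U_KinvK (i : 'I_n) : U_rel (Kinv i * K i) 1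
| U_EF (i j : 'I_n) :
    U_rel (E i * F j - F j * E i)
          (if i == j then (vi d i - (vi d i)^-1)^-1 *: (K i - Kinv i) else 0)
| U_KE (i j : 'I_n) : U_rel (K i * E j) (vi d i ^ a i j *: (E j * K i))
| U_KF (i j : 'I_n) : U_rel (K i * F j) (vi d i ^ (- a i j) *: (F j * K i))
| U_serreE (i j : 'I_n) : i != j -> U_rel (qserre d a (fun k => E k) i j) 0
| U_serreF (i j : 'I_n) : i != j -> U_rel (qserre d a (fun k => F k) i j) 0.

Definition U_algebra : Type := presented U_rel.
HB.instance Definition _ := GRing.PzRing.on U_algebra.
HB.instance Definition _ := GRing.Lmodule.on U_algebra.

Definition U_E (i : 'I_n) : U_algebra := pres_gen U_rel (UE i).
Definition U_F (i : 'I_n) : U_algebra := pres_gen U_rel (UF i).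
Definition U_K (i : 'I_n) : U_algebra := pres_gen U_rel (UK i).
Definition U_Kinv (i : 'I_n) : U_algebra := pres_gen U_rel (UKinv i).

End QuantumGroup.

Inductive S_generator (n : nat) (T : Type) : Type :=
  SE of 'I_n | SF of 'I_n | Sidem of T.
HB.instance Definition _ n T := gen_eqMixin (S_generator n T).
HB.instance Definition _ n T := gen_choiceMixin (S_generator n T).

(* The idempotents 1_l are indexed by the subtype of weights in W P, so that a
   relation such as E_i 1_l = 1_(l + alpha_i) E_i takes the element m of W P
   with val m = val l + alpha_i.  W P is finite (weyl_orbits_finite), hence the
   sums over it are genuine ones. *)
Section GeneralizedSchur.
Variables (n : nat) (a : 'M[int]_n) (d : 'I_n -> nat) (h : vectType rat).
Variables (coroot : n.-tuple h) (root : n.-tuple 'Hom(h, rat^o)).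
Variable P : set 'Hom(h, rat^o).

Local Notation WP := (weyl_orbits coroot root P).
Local Notation FS := (free_algebra Qv (S_generator n WP)).
Local Notation E i := (free_gen Qv (SE _ i) : FS).
Local Notation F i := (free_gen Qv (SF _ i) : FS).
Local Notation one l := (free_gen Qv (Sidem n l) : FS).

Inductive S_rel : FS -> FS -> Prop :=
| S_idem (l m : WP) : S_rel (one l * one m) (if l == m then one l else 0)
| S_unit : S_rel (\sum_(l \in [set: WP]) one l) 1
| S_EF (i j : 'I_n) :
    S_rel (E i * F j - F j * E i)
          (if i == j
           then \sum_(l \in [set: WP]) qint d i (wt coroot i (val l)) *: one l
           else 0)
| S_E1 (i : 'I_n) (l m : WP) :
    val m = val l + root`_i -> S_rel (E i * one l) (one m * E i)
| S_E1_0 (i : 'I_n) (l : WP) :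
    ~ WP (val l + root`_i) -> S_rel (E i * one l) 0
| S_F1 (i : 'I_n) (l m : WP) :
    val m = val l - root`_i -> S_rel (F i * one l) (one m * F i)
| S_F1_0 (i : 'I_n) (l : WP) :
    ~ WP (val l - root`_i) -> S_rel (F i * one l) 0
| S_1E (i : 'I_n) (l m : WP) :
    val m = val l - root`_i -> S_rel (one l * E i) (E i * one m)
| S_1E_0 (i : 'I_n) (l : WP) :
    ~ WP (val l - root`_i) -> S_rel (one l * E i) 0
| S_1F (i : 'I_n) (l m : WP) :
    val m = val l + root`_i -> S_rel (one l * F i) (F i * one m)
| S_1F_0 (i : 'I_n) (l : WP) :
    ~ WP (val l + root`_i) -> S_rel (one l * F i) 0
| S_serreE (i j : 'I_n) : i != j -> S_rel (qserre d a (fun k => E k) i j) 0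
| S_serreF (i j : 'I_n) : i != j -> S_rel (qserre d a (fun k => F k) i j) 0.

Definition S_algebra : Type := presented S_rel.
HB.instance Definition _ := GRing.PzRing.on S_algebra.
HB.instance Definition _ := GRing.Lmodule.on S_algebra.

Definition S_E (i : 'I_n) : S_algebra := pres_gen S_rel (SE _ i).
Definition S_F (i : 'I_n) : S_algebra := pres_gen S_rel (SF _ i).
Definition S_1 (l : WP) : S_algebra := pres_gen S_rel (Sidem n l).
Definition S_K (i : 'I_n) : S_algebra :=
  \sum_(l \in [set: WP]) vi d i ^ wt coroot i (val l) *: S_1 l.
Definition S_Kinv (i : 'I_n) : S_algebra :=
  \sum_(l \in [set: WP]) vi d i ^ (- wt coroot i (val l)) *: S_1 l.

End GeneralizedSchur.

(* Main.v *)
Require Import Defs.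
From HB Require Import structures.
From mathcomp Require Import all_boot all_order all_algebra.
From mathcomp Require Import boolp classical_sets functions cardinality fsbigop.
From mathcomp Require Import finmap monalg.

Set Implicit Arguments.
Unset Strict Implicit.
Unset Printing Implicit Defensive.

Import Order.TTheory GRing.Theory Num.Theory.
Local Open Scope classical_set_scope.
Local Open Scope ring_scope.

(** The map is prescribed on the generators of U, so it exists as soon as the
    elements E_i, F_i, K_i, K_i^-1 of S(pi) satisfy the defining relations of U.
    The Serre relations are common to both presentations.  Every other relation
    is a statement about the complete system of orthogonal idempotents 1_l:
    K_i and K_i^-1 are diagonal for it, with eigenvalue v_i^<alpha_i^vee, l> and
    its inverse on 1_l, so they commute and are inverse to each other, and
    (K_i - K_i^-1) / (v_i - v_i^-1) is diagonal with eigenvalue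
    [<alpha_i^vee, l>]_i, which is the commutator of E_i and F_i in S(pi).
    Since 1_l E_j is E_j 1_(l - alpha_j) or 0, multiplication by E_j shifts the
    eigenvalue of K_i by the factor v_i^(a_ij) ([idem_diag_shift]), and likewise
    for F_j with the inverse factor.

    Surjectivity amounts to finding each 1_l in the subalgebra generated by the
    K_i.  The coroots span the Cartan subalgebra, so two distinct weights of
    W pi differ on some coroot alpha_i^vee, and then K_i has distinct
    eigenvalues on them because v_i is not a root of unity ([vi_expz_inj]).
    As W pi is finite, Lagrange interpolation
      1_l = prod over m <> l of (K_i - v_i^<alpha_i^vee, m>) /
              (v_i^<alpha_i^vee, l> - v_i^<alpha_i^vee, m>),
    where i = i(l, m) separates l from m, expresses 1_l through the K_i
    ([idem_generated]). *)

(** * Morphisms out of free and presented algebras *)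

Section FreeAlgebra.
Variables (K : comNzRingType) (I : choiceType).

Definition free_monomial (R : nzRingType) (g : I -> R) (m : {fmonom I}) : R :=
  \prod_(i <- m) g i.

Fact free_monomial_is_mmorphism (R : nzRingType) (g : I -> R) :
  mmorphism (free_monomial g).
Proof.
split=> [x y|]; rewrite /free_monomial.
  by rewrite fmM big_cat.
by rewrite fm1 big_nil.
Qed.
HB.instance Definition _ (R : nzRingType) (g : I -> R) :=
  isMultiplicative.Build {fmonom I} R (free_monomial g)
    (free_monomial_is_mmorphism g).

(** Left multiplication by generators is enough, because a word is built from
    the empty one letter by letter. *)
Lemma free_algebra_ind (J : free_algebra K I -> Prop) :
    J 1 -> (forall x y, J x -> J y -> J (x + y)) ->
    (forall c x, J x -> J (c *: x)) ->
    (forall i x, J x -> J (free_gen K i * x)) ->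
  forall x, J x.
Proof.
move=> J1 JD JZ JM x.
have J0 : J 0 by rewrite -(scale0r 1); exact: JZ.
rewrite [x]monalgE; elim/big_ind: _ => // m _.
have -> : << x@_m *g m >> = x@_m *: << m >> :> free_algebra K I.
  by apply/malgP => k; rewrite mcoeffZ !mcoeffU mulr_natr.
apply: JZ; case: m => s; elim: s => [|i s IHs].
  by have -> : FMonom [::] = mone :> {fmonom I} by rewrite -fmoneE.
have -> : << FMonom (i :: s) >> =
          free_gen K i * << FMonom s >> :> free_algebra K I.
  rewrite /free_gen malgM_def fgmulUU mulr1; congr << _ *g _ >>.
  by apply: val_inj; rewrite /= fmM fmU.
exact: JM.
Qed.

Variables (A : algType K) (g : I -> A).

Definition free_lift : free_algebra K I -> A :=
  mmap (in_alg A) (free_monomial g).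

HB.instance Definition _ := GRing.Additive.on free_lift.

Fact free_lift_is_multiplicative : multiplicative free_lift.
Proof.
apply: commr_mmap_is_multiplicative => x m m'.
by rewrite /GRing.comm /= mulr_algl mulr_algr.
Qed.
HB.instance Definition _ := GRing.isMultiplicative.Build
  (free_algebra K I) A free_lift free_lift_is_multiplicative.

Fact free_lift_is_scalable : scalable free_lift.
Proof. by move=> c x; rewrite /free_lift mmapZ /= mulr_algl. Qed.
HB.instance Definition _ := GRing.isScalable.Build K
  (free_algebra K I) A *:%R free_lift free_lift_is_scalable.

Lemma free_lift_gen i : free_lift (free_gen K i) = g i.
Proof.
by rewrite /free_lift mmapU /= scale1r mul1r /free_monomial fmU big_seq1.
Qed.

End FreeAlgebra.

Section Presentation.
Variables (K : comNzRingType) (I : choiceType).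
Variable rel : free_algebra K I -> free_algebra K I -> Prop.

Local Notation pi := (pres_of rel : free_algebra K I -> presented rel).

HB.instance Definition _ := GRing.isAdditive.Build
  (free_algebra K I) (presented rel) pi (pres_ofB rel).

Fact pres_of_is_multiplicative : multiplicative pi.
Proof. by split=> [x y|//]; rewrite pres_ofM. Qed.
HB.instance Definition _ := GRing.isMultiplicative.Build
  (free_algebra K I) (presented rel) pi pres_of_is_multiplicative.

Fact pres_of_is_scalable : scalable pi.
Proof. by move=> c x; rewrite pres_ofZ. Qed.
HB.instance Definition _ := GRing.isScalable.Build K
  (free_algebra K I) (presented rel) *:%R pi pres_of_is_scalable.

Lemma pres_of_rel x y : rel x y -> pi x = pi y.
Proof.
by move=> rxy; apply/eqP/pres_ofP => J [_ Jrel]; apply: Jrel; exists x, y.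
Qed.

(** A presented algebra may be the zero ring, so the structure of algebra with
    its embedding of scalars does not apply to it; the scalars are embedded as
    the classes of constants instead, which makes scaling a multiplication by a
    central element. *)
Definition pres_scalar : K -> presented rel := pi \o in_alg (free_algebra K I).
HB.instance Definition _ := GRing.RMorphism.on pres_scalar.

Lemma pres_scalarE c x : pres_scalar c * x = c *: x.
Proof.
by rewrite -[x]pres_of_repr /pres_scalar /= -rmorphM /= mulr_algl linearZ.
Qed.

Lemma pres_scalar_central c x : pres_scalar c * x = x * pres_scalar c.
Proof.
by rewrite -[x]pres_of_repr /pres_scalar /= -!rmorphM /= mulr_algl mulr_algr.
Qed.

Lemma presented_ind (J : presented rel -> Prop) :
    J 1 -> (forall x y, J x -> J y -> J (x + y)) ->
    (forall c x, J x -> J (c *: x)) ->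
    (forall i x, J x -> J (pres_gen rel i * x)) ->
  forall x, J x.
Proof.
move=> J1 JD JZ JM x; rewrite -[x]pres_of_repr.
elim/free_algebra_ind: (repr x : free_algebra K I).
- by rewrite rmorph1.
- by move=> {}x y; rewrite raddfD; exact: JD.
- by move=> c {}x; rewrite linearZ; exact: JZ.
- by move=> i {}x; rewrite rmorphM; exact: JM.
Qed.

End Presentation.

Section PresentedMorphism.
Variables (K : comNzRingType) (I J : choiceType).
Variables (relI : free_algebra K I -> free_algebra K I -> Prop).
Variables (relJ : free_algebra K J -> free_algebra K J -> Prop).
Variable phi : {lrmorphism free_algebra K I -> free_algebra K J}.
Hypothesis phi_rel :
  forall x y, relI x y -> pres_of relJ (phi x) = pres_of relJ (phi y).

Definition presented_map (x : presented relI) : presented relJ :=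
  pres_of relJ (phi (repr x : free_algebra K I)).

(** The elements that phi sends to 0 in the target form a two-sided ideal
    containing the relations, hence containing the ideal they generate; so the
    value does not depend on the chosen representative. *)
Lemma presented_mapE x : presented_map (pres_of relI x) = pres_of relJ (phi x).
Proof.
rewrite /presented_map; set y : free_algebra K I := repr _.
have /eqP/pres_ofP yx : pres_of relI y = pres_of relI x.
  by rewrite /y pres_of_repr.
apply/eqP; rewrite -subr_eq0 -!raddfB /=.
apply/eqP; apply: (yx [set z | pres_of relJ (phi z) = 0]); split; last first.
  by move=> _ [z [t [/phi_rel rzt ->]]]; rewrite /= !raddfB /= rzt subrr.
split=> [|z t /= z0 t0|z l r /= z0]; first by rewrite /= !raddf0.
  by rewrite !raddfB /= z0 t0 subr0.
by rewrite !rmorphM /= z0 mulr0 mul0r.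
Qed.

Lemma presented_morphism :
  exists f : {rmorphism presented relI -> presented relJ},
    scalable f /\ forall x, f (pres_of relI x) = pres_of relJ (phi x).
Proof.
have mapB : additive presented_map.
  move=> x y; rewrite -[x]pres_of_repr -[y]pres_of_repr -raddfB.
  by rewrite !presented_mapE !raddfB.
have mapM : multiplicative presented_map.
  split=> [x y|]; last first.
    by rewrite -(rmorph1 (pres_of relI)) presented_mapE !rmorph1.
  rewrite -[x]pres_of_repr -[y]pres_of_repr -rmorphM.
  by rewrite !presented_mapE !rmorphM.
pose f := HB.pack_for {rmorphism presented relI -> presented relJ} presented_map
  (GRing.isAdditive.Build _ _ presented_map mapB)
  (GRing.isMultiplicative.Build _ _ presented_map mapM).
exists f; split=> [c x|x]; last exact: presented_mapE.
rewrite -[x]pres_of_repr -[in LHS]linearZ /=.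
by rewrite !presented_mapE !linearZ.
Qed.

End PresentedMorphism.

(** * Powers of v_i *)

Lemma qv_exp_eq1 m : (qv ^+ m == 1) = (m == 0)%N.
Proof.
rewrite /qv -tofracXn -tofrac1 tofrac_eq; apply/eqP/eqP => [|->//].
move/(congr1 (fun p : {poly rat} => size p)).
by rewrite size_polyXn size_poly1 => -[].
Qed.

Lemma qv_neq0 : qv != 0.
Proof. by rewrite /qv tofrac_eq0 polyX_eq0. Qed.

Lemma vi_neq0 n (d : 'I_n -> nat) i : vi d i != 0.
Proof. by rewrite /vi expf_neq0 // qv_neq0. Qed.

Lemma vi_expz_inj n (d : 'I_n -> nat) i : (0 < d i)%N ->
  injective (fun z : int => vi d i ^ z).
Proof.
move=> d_gt0 x y; wlog le_xy : x y / x <= y => [wlg|] /= vxy.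
  by have [/wlg|/ltW/wlg] := leP x y; [exact|move=> H; apply/esym/H].
have : vi d i ^ (y - x) == 1.
  by rewrite expfzDr ?vi_neq0 // -vxy -expfzDr ?vi_neq0 // subrr expr0z.
have /ger0_norm <- : 0 <= y - x by rewrite subr_ge0.
rewrite /vi -[_ ^ _]/(_ ^+ _) -exprM qv_exp_eq1 muln_eq0.
rewrite eqn0Ngt d_gt0 /= absz_eq0 subr_eq0.
by move/eqP.
Qed.

(** * Complete systems of orthogonal idempotents *)

Section CompleteIdempotents.
Variables (K : comNzRingType) (A : pzRingType) (z : {rmorphism K -> A}).
Hypothesis z_central : forall c x, z c * x = x * z c.
Variables (T : choiceType) (e : T -> A).
Hypothesis finite_T : finite_set [set: T].
Hypothesis e_mul : forall l m, e l * e m = if l == m then e l else 0.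
Hypothesis e_sum : \sum_(l \in [set: T]) e l = 1.

Definition idem_diag (c : T -> K) : A := \sum_(l \in [set: T]) z (c l) * e l.

Lemma idem_diagE c : idem_diag c = \sum_(l <- fset_set [set: T]) z (c l) * e l.
Proof. by rewrite /idem_diag fsbig_finite. Qed.

Lemma idem_diag1 : idem_diag (fun=> 1) = 1.
Proof. by rewrite -e_sum; apply: eq_fsbigr => l _; rewrite rmorph1 mul1r. Qed.

Lemma idem_diagZ k c : z k * idem_diag c = idem_diag (fun l => k * c l).
Proof.
rewrite !idem_diagE mulr_sumr; apply: eq_bigr => l _.
by rewrite rmorphM mulrA.
Qed.

Lemma idem_diagB c c' :
  idem_diag c - idem_diag c' = idem_diag (fun l => c l - c' l).
Proof.
rewrite !idem_diagE -sumrB; apply: eq_bigr => l _.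
by rewrite rmorphB mulrBl.
Qed.

Lemma idem_mul_diag c l : e l * idem_diag c = z (c l) * e l.
Proof.
rewrite idem_diagE mulr_sumr.
rewrite (bigD1_seq l) ?fset_uniq ?in_fset_set ?in_setT //=.
rewrite mulrA -z_central -mulrA e_mul eqxx big1 ?addr0 // => m ml.
by rewrite mulrA -z_central -mulrA e_mul eq_sym (negPf ml) mulr0.
Qed.

Lemma idem_ext x y : (forall l, e l * x = e l * y) -> x = y.
Proof.
move=> xy; rewrite -[x]mul1r -[y]mul1r -e_sum fsbig_finite // !mulr_suml.
by apply: eq_bigr.
Qed.

Lemma idem_diagM c c' :
  idem_diag c * idem_diag c' = idem_diag (fun l => c l * c' l).
Proof.
apply: idem_ext => l.
by rewrite mulrA !idem_mul_diag -mulrA idem_mul_diag mulrA -rmorphM.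
Qed.

(** Comparing both sides after multiplication by each e l on the left replaces
    the reindexing of a sum along a partial shift l |-> m by a case analysis. *)
Lemma idem_diag_shift x (c : T -> K) k :
    (forall l, e l * x = 0 \/
       exists2 m, e l * x = x * e m & c l = k * c m) ->
  idem_diag c * x = z k * (x * idem_diag c).
Proof.
move=> x_shift; apply: idem_ext => l.
rewrite mulrA idem_mul_diag [RHS]mulrA -z_central -!mulrA [e l * (x * _)]mulrA.
have [->|[m -> ->]] := x_shift l; first by rewrite mul0r !mulr0.
rewrite -[x * e m * _]mulrA idem_mul_diag [x * (z _ * _)]mulrA -z_central.
by rewrite -mulrA [RHS]mulrA -rmorphM.
Qed.

End CompleteIdempotents.

Section DiagonalGeneration.
Variables (K : fieldType) (A : pzRingType) (z : {rmorphism K -> A}).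
Hypothesis z_central : forall c x, z c * x = x * z c.
Variables (T : choiceType) (e : T -> A).
Hypothesis finite_T : finite_set [set: T].
Hypothesis e_mul : forall l m, e l * e m = if l == m then e l else 0.
Hypothesis e_sum : \sum_(l \in [set: T]) e l = 1.

(** Lagrange interpolation: a product of affine functions of the given diagonal
    elements, one for each m != l, takes the value 1 at l and vanishes at all
    other indices.  The product is built by induction on the list of the indices
    m that have been killed so far. *)
Lemma idem_generated (X : Type) (c : X -> T -> K) (J : A -> Prop) :
    (forall l m, l != m -> exists i, c i l != c i m) ->
    (forall k, J (z k)) -> (forall x y, J x -> J y -> J (x + y)) ->
    (forall x y, J x -> J y -> J (x * y)) ->
    (forall i, J (idem_diag z e (c i))) ->
  forall l, J (e l).
Proof.
move=> c_sep Jz JD JM Jc l.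
suff [b [Jb bl b0]] : exists b, [/\ J (idem_diag z e b), b l = 1 &
    forall m, m \in (fset_set [set: T] : seq T) -> m != l -> b m = 0].
  suff -> : e l = idem_diag z e b by [].
  apply: (idem_ext finite_T e_sum) => m.
  rewrite e_mul idem_mul_diag //; have [->|ml] := eqVneq m l.
    by rewrite bl rmorph1 mul1r.
  by rewrite b0 ?rmorph0 ?mul0r // in_fset_set ?in_setT.
elim: (fset_set _ : seq _) => [|m s [b [Jb bl b0]]].
  by exists (fun=> 1); split=> //; rewrite idem_diag1 // -(rmorph1 z).
have [->|ml] := eqVneq m l.
  exists b; split=> // k; rewrite inE => /predU1P[->|]; last exact: b0.
  by rewrite eqxx.
have [i c_ml] := c_sep _ _ ml.
(* The affine function of c i that is 1 at l and 0 at m; the factor 1 lets it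
   be read as a combination of diagonal elements. *)
pose q k := (c i l - c i m)^-1 * (c i k - c i m * 1).
exists (fun k => q k * b k); split.
- rewrite -idem_diagM // /q -idem_diagZ // -idem_diagB //.
  rewrite -(idem_diagZ _ _ finite_T (c i m)) idem_diag1 // mulr1 -rmorphN.
  by apply: (JM _ _ _ Jb); apply/JM/JD.
- by rewrite bl mulr1 /q mulr1 mulVf // subr_eq0 eq_sym.
- move=> k; rewrite inE => /predU1P[-> _|ks kl]; last by rewrite b0 ?mulr0.
  by rewrite /q mulr1 subrr mulr0 mul0r.
Qed.

End DiagonalGeneration.

(** * The relations of U in the generalized Schur algebra *)

(** Over abstract rings and with named images, so that relations between
    generators of a free algebra are transported without ever comparing two
    products of generators up to conversion. *)
Lemma rmorphM_eq (R R' : pzRingType) (f : {rmorphism R -> R'}) x y x' y' :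
  f x = x' -> f y = y' -> f (x * y) = x' * y'.
Proof. by move=> <- <-; exact: rmorphM. Qed.

Lemma rmorphMB_eq (R R' : pzRingType) (f : {rmorphism R -> R'})
    x y u w x' y' u' w' :
  f x = x' -> f y = y' -> f u = u' -> f w = w' ->
  f (x * y - u * w) = x' * y' - u' * w'.
Proof. by move=> <- <- <- <-; rewrite rmorphB !rmorphM. Qed.

Lemma qserre_map n (a : 'M[int]_n) (d : 'I_n -> nat) (A B : algType Qv)
    (f : {lrmorphism A -> B}) (x : 'I_n -> A) i j :
  f (qserre d a x i j) = qserre d a (f \o x) i j.
Proof.
rewrite /qserre rmorph_sum; apply: eq_bigr => s _ /=.
by rewrite linearZ !rmorphM !rmorphXn.
Qed.

Section SchurAlgebra.
Variables (n : nat) (a : 'M[int]_n) (d : 'I_n -> nat) (h : vectType rat).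
Variables (coroot : n.-tuple h) (root : n.-tuple 'Hom(h, rat^o)).
Variable P : set 'Hom(h, rat^o).
Hypothesis cartan_a : finite_type_cartan a d.
Hypothesis real_a : realization a coroot root.
Hypothesis P_dominant : P `<=` dominant_weight coroot.
Hypothesis P_finite : finite_set P.

Local Notation WP := (weyl_orbits coroot root P).
Local Notation S := (S_algebra a d coroot root P).
Local Notation idem := (@S_1 n a d h coroot root P).
Local Notation weight i l := (wt coroot i (val (l : WP))).
Local Notation rel := (@S_rel n a d h coroot root P).

Lemma finite_WP : finite_set [set: WP].
Proof.
rewrite (eq_finite_set (card_setT _)).
exact: (weyl_orbits_finite cartan_a real_a P_dominant P_finite).
Qed.

Lemma S_1M l m : idem l * idem m = if l == m then idem l else 0.
Proof.
rewrite /S_1 /pres_gen -rmorphM /= (pres_of_rel (S_idem a d l m)).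
by case: ifP => // _; rewrite raddf0.
Qed.

Lemma S_1_sum : \sum_(l \in [set: WP]) idem l = 1.
Proof.
have /= := pres_of_rel (S_unit a d coroot root P); rewrite rmorph1 => <-.
by rewrite !fsbig_finite ?raddf_sum //; exact: finite_WP.
Qed.

Local Notation diag :=
  (idem_diag (@pres_scalar _ _ rel) (idem : WP -> presented rel)).
Local Notation diagM :=
  (idem_diagM (@pres_scalar_central _ _ rel) finite_WP S_1M S_1_sum).

Lemma pres_of_weight_sum (c : WP -> Qv) :
  pres_of rel (\sum_(l \in [set: WP]) c l *: free_gen Qv (Sidem n l)) = diag c.
Proof.
rewrite idem_diagE ?fsbig_finite /=; try exact: finite_WP.
by rewrite raddf_sum; apply: eq_bigr => l _ /=; rewrite pres_scalarE linearZ.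
Qed.

Lemma S_KE i : S_K a d coroot root P i = diag (fun l => vi d i ^ weight i l).
Proof. by apply: eq_fsbigr => l _; rewrite pres_scalarE. Qed.

Lemma S_KinvE i :
  S_Kinv a d coroot root P i = diag (fun l => vi d i ^ (- weight i l)).
Proof. by apply: eq_fsbigr => l _; rewrite pres_scalarE. Qed.

Lemma weight_root (i j : 'I_n) (l m : WP) : val m = val l + root`_j ->
  weight i m = weight i l + a i j.
Proof.
have [_ rootE] := real_a.
move=> ml; apply: (@intr_inj rat); rewrite rmorphD /=.
rewrite !(wtE real_a i P_dominant (set_valP _)).
by rewrite [X in fun_of_lfun X]ml lfun_simp /= rootE.
Qed.

Lemma S_K_E i j :
  S_K a d coroot root P i * S_E a d coroot root P j =
  vi d i ^ a i j *: (S_E a d coroot root P j * S_K a d coroot root P i).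
Proof.
rewrite S_KE -pres_scalarE.
apply: (idem_diag_shift (@pres_scalar_central _ _ rel)
  finite_WP S_1M S_1_sum) => l.
have [WPm|WPm] := pselect (WP (val l - root`_j)); last first.
  left; rewrite /S_1 /S_E /pres_gen -rmorphM /=.
  by rewrite (pres_of_rel (S_1E_0 a d WPm)) raddf0.
have [m val_m] : exists m : WP, val m = val l - root`_j.
  by exists (SigSub (mem_set WPm)).
right; exists m.
  rewrite /S_1 /S_E /pres_gen -!rmorphM /=.
  exact: (pres_of_rel (S_1E a d val_m)).
rewrite -expfzDr ?vi_neq0 // addrC -(@weight_root i j m l) //.
by rewrite val_m subrK.
Qed.

Lemma S_K_F i j :
  S_K a d coroot root P i * S_F a d coroot root P j =
  vi d i ^ (- a i j) *: (S_F a d coroot root P j * S_K a d coroot root P i).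
Proof.
rewrite S_KE -pres_scalarE.
apply: (idem_diag_shift (@pres_scalar_central _ _ rel)
  finite_WP S_1M S_1_sum) => l.
have [WPm|WPm] := pselect (WP (val l + root`_j)); last first.
  left; rewrite /S_1 /S_F /pres_gen -rmorphM /=.
  by rewrite (pres_of_rel (S_1F_0 a d WPm)) raddf0.
have [m val_m] : exists m : WP, val m = val l + root`_j.
  by exists (SigSub (mem_set WPm)).
right; exists m.
  rewrite /S_1 /S_F /pres_gen -!rmorphM /=.
  exact: (pres_of_rel (S_1F a d val_m)).
by rewrite -expfzDr ?vi_neq0 // (weight_root i val_m) addrC addrK.
Qed.

(** The coroots form a basis of the Cartan subalgebra, so a weight is determined
    by its integer values on them. *)
Lemma weight_separated (l m : WP) : l != m ->
  exists i, weight i l != weight i m.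
Proof.
have [coroot_basis _] := real_a.
move=> lm; apply/existsP; apply: contraNT lm.
rewrite negb_exists => /forallP lm.
apply/eqP/val_inj/lfunP => x.
rewrite (coord_basis coroot_basis (memvf x)) !linear_sum.
apply: eq_bigr => i _; rewrite !linearZ /=; congr (_ *: _).
rewrite -!(wtE real_a i P_dominant (set_valP _)).
by have /negPn/eqP -> := lm i.
Qed.

Lemma S_1_generated (J : S -> Prop) :
    J 1 -> (forall x y, J x -> J y -> J (x + y)) ->
    (forall c x, J x -> J (c *: x)) -> (forall x y, J x -> J y -> J (x * y)) ->
    (forall i, J (S_K a d coroot root P i)) ->
  forall l, J (idem l).
Proof.
move=> J1 JD JZ JM JK.
apply: (idem_generated (@pres_scalar_central _ _ rel) finite_WP S_1M S_1_sum
  (c := fun i l => vi d i ^ weight i l)) => //.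
- move=> l m /weight_separated[i wt_lm]; exists i.
  apply: contra_neq wt_lm; apply: vi_expz_inj.
  by have [_ _ d13 _ _] := cartan_a; case/andP: (d13 i).
- by move=> k /=; rewrite -[pres_scalar rel k]mulr1 pres_scalarE; exact: JZ.
- by move=> i; rewrite -S_KE.
Qed.

Lemma S_K_comm i j :
  S_K a d coroot root P i * S_K a d coroot root P j =
  S_K a d coroot root P j * S_K a d coroot root P i.
Proof.
rewrite !S_KE [LHS]diagM [RHS]diagM; congr idem_diag.
by apply/funext => l; rewrite mulrC.
Qed.

Lemma S_K_Kinv i : S_K a d coroot root P i * S_Kinv a d coroot root P i = 1.
Proof.
rewrite S_KE S_KinvE [LHS]diagM.
rewrite -[RHS](idem_diag1 (@pres_scalar _ _ rel) S_1_sum).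
congr idem_diag; apply/funext => l.
by rewrite -expfzDr ?vi_neq0 // subrr.
Qed.

Lemma S_Kinv_K i : S_Kinv a d coroot root P i * S_K a d coroot root P i = 1.
Proof.
rewrite -(S_K_Kinv i) S_KE S_KinvE [LHS]diagM [RHS]diagM; congr idem_diag.
by apply/funext => l; rewrite mulrC.
Qed.

Lemma S_E_F i j :
  S_E a d coroot root P i * S_F a d coroot root P j -
  S_F a d coroot root P j * S_E a d coroot root P i =
  if i == j then (vi d i - (vi d i)^-1)^-1 *:
    (S_K a d coroot root P i - S_Kinv a d coroot root P i) else 0.
Proof.
apply: (etrans (esym
  (rmorphMB_eq (f := pres_of rel) erefl erefl erefl erefl))).
apply: (etrans (pres_of_rel (S_EF a d coroot root P i j))).
case: eqP => _; last by rewrite raddf0.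
rewrite pres_of_weight_sum S_KE S_KinvE.
rewrite (idem_diagB _ _ finite_WP) -pres_scalarE.
rewrite [RHS](idem_diagZ _ _ finite_WP).
by congr idem_diag; apply/funext => l; rewrite mulrC.
Qed.

(** The lift goes to the free algebra, which is a nonzero algebra in which the
    Serre expressions make sense; the quotient S(pi) may be zero. *)
Definition gen_lift (g : U_generator n) : free_algebra Qv (S_generator n WP) :=
  match g with
  | UE i => free_gen Qv (SE _ i)
  | UF i => free_gen Qv (SF _ i)
  | UK i => \sum_(l \in [set: WP])
      vi d i ^ weight i l *: free_gen Qv (Sidem n l)
  | UKinv i => \sum_(l \in [set: WP])
      vi d i ^ (- weight i l) *: free_gen Qv (Sidem n l)
  end.

Definition gen_image (g : U_generator n) : S :=
  match g with
  | UE i => S_E a d coroot root P i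
  | UF i => S_F a d coroot root P i
  | UK i => S_K a d coroot root P i
  | UKinv i => S_Kinv a d coroot root P i
  end.

Lemma pres_of_gen_lift g : pres_of rel (gen_lift g) = gen_image g.
Proof.
case: g => i //=; first by rewrite pres_of_weight_sum -S_KE.
by rewrite pres_of_weight_sum -S_KinvE.
Qed.

Definition free_to_S : free_algebra Qv (U_generator n) -> presented rel :=
  pres_of rel \o free_lift gen_lift.
HB.instance Definition _ := GRing.RMorphism.on free_to_S.
HB.instance Definition _ := GRing.Linear.on free_to_S.

Lemma free_to_S_gen g : free_to_S (free_gen Qv g) = gen_image g.
Proof. by rewrite /free_to_S /= free_lift_gen pres_of_gen_lift. Qed.

Lemma free_to_S_rel x y : U_rel a d x y -> free_to_S x = free_to_S y.
Proof.
have EE : free_lift gen_lift \o (fun k => free_gen Qv (UE k)) =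
    (fun k => free_gen Qv (SE WP k)).
  by apply/funext => k; exact: free_lift_gen.
have FF : free_lift gen_lift \o (fun k => free_gen Qv (UF k)) =
    (fun k => free_gen Qv (SF WP k)).
  by apply/funext => k; exact: free_lift_gen.
pose G g := free_gen Qv (g : U_generator n).
have thetaM g g' : free_to_S (G g * G g') = gen_image g * gen_image g'.
  by apply: rmorphM_eq; exact: free_to_S_gen.
have thetaMB g g' k k' : free_to_S (G g * G g' - G k * G k') =
    gen_image g * gen_image g' - gen_image k * gen_image k'.
  by apply: rmorphMB_eq; exact: free_to_S_gen.
case=> [i j|i|i|i j|i j|i j|i j ij|i j ij].
- exact: (etrans (thetaM (UK i) (UK j))
    (etrans (S_K_comm i j) (esym (thetaM (UK j) (UK i))))).
- rewrite rmorph1; exact: (etrans (thetaM (UK i) (UKinv i)) (S_K_Kinv i)).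
- rewrite rmorph1; exact: (etrans (thetaM (UKinv i) (UK i)) (S_Kinv_K i)).
- apply: (etrans (thetaMB (UE i) (UF j) (UF j) (UE i))).
  apply: (etrans (S_E_F i j)).
  case: eqP => _; last by rewrite raddf0.
  rewrite linearZ; congr (_ *: _).
  apply/esym; apply: (etrans (raddfB _ _ _)).
  by rewrite /= (free_to_S_gen (UK i)) (free_to_S_gen (UKinv i)).
- rewrite linearZ; apply: (etrans (thetaM (UK i) (UE j))).
  apply: (etrans (S_K_E i j)); congr (_ *: _).
  exact: esym (thetaM (UE j) (UK i)).
- rewrite linearZ; apply: (etrans (thetaM (UK i) (UF j))).
  apply: (etrans (S_K_F i j)); congr (_ *: _).
  exact: esym (thetaM (UF j) (UK i)).
- rewrite raddf0 /free_to_S /= qserre_map EE.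
  by rewrite (pres_of_rel (S_serreE _ _ _ _ _ ij)) raddf0.
- rewrite raddf0 /free_to_S /= qserre_map FF.
  by rewrite (pres_of_rel (S_serreF _ _ _ _ _ ij)) raddf0.
Qed.

End SchurAlgebra.

Theorem proposition3p4 (n : nat) (a : 'M[int]_n) (d : 'I_n -> nat)
    (h : vectType rat) (coroot : n.-tuple h) (root : n.-tuple 'Hom(h, rat^o))
    (P : set 'Hom(h, rat^o))
    (cartan_a : finite_type_cartan a d)
    (real_a : realization a coroot root)
    (P_dominant : P `<=` dominant_weight coroot)
    (P_finite : finite_set P)
    (P_saturated : saturated coroot root P) :
  exists f : {rmorphism U_algebra a d -> S_algebra a d coroot root P},
    scalable f /\
    (forall i : 'I_n,
      [/\ f (U_E a d i) = S_E a d coroot root P i,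
          f (U_F a d i) = S_F a d coroot root P i,
          f (U_K a d i) = S_K a d coroot root P i
        & f (U_Kinv a d i) = S_Kinv a d coroot root P i]) /\
    (forall y : S_algebra a d coroot root P,
      exists x : U_algebra a d, f x = y).
Proof.
have [f [fZ fE]] := presented_morphism
  (free_to_S_rel cartan_a real_a P_dominant P_finite).
have f_gen g : f (pres_gen _ g) = gen_image a d coroot root P g.
  by rewrite fE; exact: (free_to_S_gen cartan_a real_a P_dominant P_finite).
exists f; split=> //; split=> [i|]; first by split; exact: f_gen.
pose J y := exists x, f x = y.
have J1 : J 1 by exists 1; rewrite rmorph1.
have JD x y : J x -> J y -> J (x + y).
  by move=> [x' <-] [y' <-]; exists (x' + y'); rewrite raddfD.
have JZ c x : J x -> J (c *: x) by move=> [x' <-]; exists (c *: x'); rewrite fZ.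
have JM x y : J x -> J y -> J (x * y).
  by move=> [x' <-] [y' <-]; exists (x' * y'); rewrite rmorphM.
apply: (presented_ind J1 JD JZ) => g x; apply: (JM).
case: g => [i|i|l].
- by exists (U_E a d i); exact: f_gen.
- by exists (U_F a d i); exact: f_gen.
apply: (S_1_generated cartan_a real_a P_dominant P_finite J1 JD JZ JM) => i.
by exists (U_K a d i); exact: f_gen.
Qed.
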